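(* Let $S$ be a $\Gamma$-semiring which has a left unity and a right unity, and let $L$ be its left operator semiring. For a fuzzy subset $\mu$ of $L$ let $\mu^{+}$ be the fuzzy subset of $S$ defined by $\mu^{+}(a)=\inf_{\alpha\in\Gamma}\mu([a,\alpha])$ for $a\in S$. Then: (1) if $\mu$ is a fuzzy left ideal of $L$, then $\mu^{+}$ is a fuzzy left ideal of $S$; (2) if $\mu$ is a fuzzy right ideal of $L$, then $\mu^{+}$ is a fuzzy right ideal of $S$; (3) if $\mu$ is a fuzzy ideal of $L$, then $\mu^{+}$ is a fuzzy ideal of $S$.
   Context: $\Gamma$-semiring: $S$ and $\Gamma$ are (nonempty) additive commutative semigroups with a map $S\times\Gamma\times S\to S$, $(a,\alpha,b)\mapsto a\alpha b$, such that $a\alpha(b+c)=a\alpha b+a\alpha c$, $(a+b)\alpha c=a\alpha c+b\alpha c$, $a(\alpha+\beta)c=a\alpha c+a\beta c$, $a\alpha(b\beta c)=(a\alpha b)\beta c$ for all $a,b,c\in S$, $\alpha,\beta\in\Gamma$. No zero elements are assumed. Left operator semiring $L$: let $F$ be the free additive commutative semigroup generated by $S\times\Gamma$ (finite nonempty formal sums). The relation $\sum_i(x_i,\alpha_i)\,\rho\,\sum_j(y_j,\beta_j)$ iff $\sum_i x_i\alpha_i a=\sum_j y_j\beta_j a$ for all $a\in S$ is a congruence on $F$. The class of $\sum_i(x_i,\alpha_i)$ is written $\sum_i[x_i,\alpha_i]$. $L=F/\rho$ with the induced addition and the multiplication $(\sum_i[x_i,\alpha_i])(\sum_j[y_j,\beta_j])=\sum_{i,j}[x_i\alpha_i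 y_j,\beta_j]$ is a semiring. Unities: a left unity of $S$ is a finite sum $\sum_i[e_i,\delta_i]\in L$ with $\sum_i e_i\delta_i a=a$ for all $a\in S$. A right unity of $S$ is given by finitely many $\gamma_j\in\Gamma$, $f_j\in S$ with $\sum_j a\gamma_j f_j=a$ for all $a\in S$. A fuzzy subset of a set $X$ is a function $X\to[0,1]$. A fuzzy subset $\mu$ of $S$ is a fuzzy left (respectively right) ideal of $S$ if for all $a,b\in S$, $\alpha\in\Gamma$: $\mu(a+b)\ge\min(\mu(a),\mu(b))$ and $\mu(a\alpha b)\ge\mu(b)$ (respectively $\mu(a\alpha b)\ge\mu(a)$). A fuzzy subset $\mu$ of $L$ is a fuzzy left (respectively right) ideal of $L$ if for all $p,q\in L$: $\mu(p+q)\ge\min(\mu(p),\mu(q))$ and $\mu(pq)\ge\mu(q)$ (respectively $\mu(pq)\ge\mu(p)$). A fuzzy ideal (of $S$ or of $L$) is a fuzzy subset that is both a fuzzy left ideal and a fuzzy right ideal. *)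

(* Defs.v *)
From HB Require Import structures.
From mathcomp Require Import all_boot all_order all_algebra finmap multiset.
From mathcomp Require Import boolp classical_sets reals interval_inference.
Set Implicit Arguments.
Unset Strict Implicit.
Unset Printing Implicit Defensive.
Import Order.TTheory GRing.Theory Num.Theory.
Local Open Scope quotient_scope.
Local Open Scope mset_scope.
Local Open Scope ring_scope.

(* Formal sums are finite *nonempty* multisets of generators, as no zero is   *)
(* available: this is the free additive commutative semigroup on T.           *)
Record fsum (T : choiceType) := FSum {
  fsum_mset :> {mset T};
  fsum_neq0 : fsum_mset != mset0 }.
HB.instance Definition _ (T : choiceType) := [isSub for @fsum_mset T].
HB.instance Definition _ (T : choiceType) := [Choice of fsum T by <:].

Section FormalSum.
Variable T : choiceType.
Implicit Types X Y Z : fsum T.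

Fact fsum_add_subproof X Y : (X `+` Y)%mset != mset0.
Proof.
case: (mset_0Vmem X) (fsum_neq0 X) => [->|[x xX] _]; first by rewrite eqxx.
apply/eqP => XY0; have : x \in (X `+` Y)%mset by rewrite in_msetD xX.
by rewrite XY0 in_mset0.
Qed.
Definition fsum_add X Y := FSum (fsum_add_subproof X Y).

Fact fsum_addC : commutative fsum_add.
Proof. by move=> X Y; apply: val_inj; apply: msetDC. Qed.
Fact fsum_addA : associative fsum_add.
Proof. by move=> X Y Z; apply: val_inj; apply: msetDA. Qed.
HB.instance Definition _ :=
  Algebra.isAddSemigroup.Build (fsum T) fsum_addC fsum_addA.

Fact fsum1_subproof (x : T) : [mset x]%mset != mset0.
Proof. by rewrite -size_mset_eq0 enum_msetn. Qed.
Definition fsum1 (x : T) : fsum T := FSum (fsum1_subproof x).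

Lemma fsum_ind (P : fsum T -> Prop) :
  (forall x, P (fsum1 x)) -> (forall X Y, P X -> P Y -> P (X + Y)) ->
  forall X, P X.
Proof.
move=> P1 PD [A A0]; have [s defA] : {s | A = seq_mset s}.
  by exists (enum_mset A); rewrite seq_mset_id.
elim: s A A0 defA => [|x s IHs] A A0 defA.
  by case/negP: (A0); rewrite -size_mset_eq0 defA (perm_size (perm_eq_seq_mset _)).
have [s0|s_neq0] := eqVneq (seq_mset s) mset0.
  rewrite (_ : FSum A0 = fsum1 x) //; apply: val_inj => /=.
  by rewrite defA mset_cons s0 msetD0.
rewrite (_ : FSum A0 = fsum1 x + FSum s_neq0); first exact: PD (IHs _ _ _).
by apply: val_inj; rewrite /= defA mset_cons.
Qed.

Section Eval.
Variables (V : addSemigroupType) (f : T -> V).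

(* V has no zero, so the sum is computed in option V, with None neutral. *)
Definition fsum_oeval (A : {mset T}) : option V :=
  \big[oAC (@Algebra.addrA V) (@Algebra.addrC V)/None]_(x <- A) Some (f x).

Lemma fsum_oevalD A B : fsum_oeval (A `+` B)%mset =
  oAC (@Algebra.addrA V) (@Algebra.addrC V) (fsum_oeval A) (fsum_oeval B).
Proof.
rewrite /fsum_oeval -big_cat; apply: perm_big.
by apply/allP => x _ /=; rewrite count_cat !count_mem_mset msetE2.
Qed.

Lemma fsum_oeval1 x : fsum_oeval [mset x]%mset = Some (f x).
Proof. by rewrite /fsum_oeval enum_msetn big_seq1. Qed.

Fact fsum_oeval_some X : isSome (fsum_oeval X).
Proof.
elim/fsum_ind: X => [x|X Y]; first by rewrite fsum_oeval1.
by rewrite fsum_oevalD; do 2!case: (fsum_oeval _).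
Qed.

Definition fsum_eval X : V :=
  match fsum_oeval X as o return isSome o -> V with
  | Some v => fun=> v
  | None => fun abs => False_rect V (notF abs)
  end (fsum_oeval_some X).

Lemma fsum_evalE X : Some (fsum_eval X) = fsum_oeval X.
Proof. by rewrite /fsum_eval; move: (fsum_oeval_some X); case: fsum_oeval. Qed.

Lemma fsum_eval1 x : fsum_eval (fsum1 x) = f x.
Proof. by apply: Some_inj; rewrite fsum_evalE fsum_oeval1. Qed.

Lemma fsum_evalD X Y : fsum_eval (X + Y) = fsum_eval X + fsum_eval Y.
Proof. by apply: Some_inj; rewrite fsum_evalE fsum_oevalD -!fsum_evalE. Qed.

End Eval.

Lemma eq_fsum_eval (V : addSemigroupType) (f g : T -> V) X :
  f =1 g -> fsum_eval f X = fsum_eval g X.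
Proof.
move=> fg; elim/fsum_ind: X => [x|X Y IX IY]; first by rewrite !fsum_eval1.
by rewrite !fsum_evalD IX IY.
Qed.

Lemma fsum_eval_morph (V W : addSemigroupType) (h : V -> W) (f : T -> V) X :
  (forall u v, h (u + v) = h u + h v) ->
  h (fsum_eval f X) = fsum_eval (h \o f) X.
Proof.
move=> hD; elim/fsum_ind: X => [x|X Y IX IY]; first by rewrite !fsum_eval1.
by rewrite !fsum_evalD hD IX IY.
Qed.

Lemma fsum_evalDf (V : addSemigroupType) (f g : T -> V) X :
  fsum_eval (fun x => f x + g x) X = fsum_eval f X + fsum_eval g X.
Proof.
elim/fsum_ind: X => [x|X Y IX IY]; first by rewrite !fsum_eval1.
by rewrite !fsum_evalD IX IY -!Algebra.addrA; congr (_ + _); rewrite Algebra.addrCA.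
Qed.

End FormalSum.

Reserved Notation "a *[ al ] b"
  (at level 40, al at level 99, b at next level, format "a  *[ al ]  b").

HB.mixin Record AddSemigroup_isGammaSemiring (G : addSemigroupType) S
    of Algebra.AddSemigroup S := {
  gmul : S -> G -> S -> S;
  gmulDr : forall a al (b c : S), gmul a al (b + c) = gmul a al b + gmul a al c;
  gmulDl : forall (a b : S) al c, gmul (a + b) al c = gmul a al c + gmul b al c;
  gmulDm : forall a (al be : G) c, gmul a (al + be) c = gmul a al c + gmul a be c;
  gmulA : forall a al b be c, gmul a al (gmul b be c) = gmul (gmul a al b) be c;
  gsemiring_inhabited : inhabited S;
  gsemiring_gamma_inhabited : inhabited G }.

#[short(type="gammaSemiringType")]
HB.structure Definition GammaSemiring (G : addSemigroupType) :=
  {S of AddSemigroup_isGammaSemiring G S & Algebra.AddSemigroup S}.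

Notation "a *[ al ] b" := (gmul a al b) : ring_scope.

(* Semiring without zero nor one: MathComp's semirings are all unital with 0. *)
HB.mixin Record AddSemigroup_isSemirng R of Algebra.AddSemigroup R & Semigroup R := {
  semirng_mulDl : forall p q r : R, ((p + q)%R * r)%g = ((p * r)%g + (q * r)%g)%R;
  semirng_mulDr : forall p q r : R, (p * (q + r)%R)%g = ((p * q)%g + (p * r)%g)%R }.

#[short(type="semirngType")]
HB.structure Definition Semirng :=
  {R of AddSemigroup_isSemirng R & Algebra.AddSemigroup R & Semigroup R}.

Section LeftOperatorSemiring.
Variables (G : addSemigroupType) (S : gammaSemiringType G).
Local Notation F := (fsum (S * G)%type).
Implicit Types X Y Z : F.

(* \sum_i x_i al_i a, for X = \sum_i (x_i, al_i). *)
Definition fsum_act X (a : S) : S := fsum_eval (fun u => u.1 *[u.2] a) X.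

Definition rho : rel F := fun X Y => `[< forall a, fsum_act X a = fsum_act Y a >].

Lemma rhoP X Y : reflect (fsum_act X =1 fsum_act Y) (rho X Y).
Proof. exact: asboolP. Qed.

Fact rho_refl : reflexive rho.
Proof. by move=> X; apply/rhoP. Qed.
Fact rho_sym : symmetric rho.
Proof. by move=> X Y; apply/rhoP/rhoP => XY a; rewrite XY. Qed.
Fact rho_trans : transitive rho.
Proof. by move=> Y X Z /rhoP XY /rhoP YZ; apply/rhoP => a; rewrite XY. Qed.
Canonical rho_equiv := EquivRel rho rho_refl rho_sym rho_trans.

Definition left_operator := {eq_quot rho}.
HB.instance Definition _ := Choice.on left_operator.
HB.instance Definition _ := EqQuotient.on left_operator.
Local Notation L := left_operator.

(* The class [x, al] of a generator. *)
Definition lop_gen (x : S) (al : G) : L := \pi_L (fsum1 (x, al)).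

Definition lop_act (p : L) (a : S) : S := fsum_act (repr p) a.

Lemma lop_act_pi X : lop_act (\pi_L X) =1 fsum_act X.
Proof. by apply/rhoP; rewrite -eqmodE reprK. Qed.

Lemma lop_ext (p q : L) : lop_act p =1 lop_act q -> p = q.
Proof. by move=> pq; rewrite -[p]reprK -[q]reprK; apply/eqmodP/rhoP. Qed.

(* \sum_(i, j) (x_i al_i y_j, be_j). *)
Definition fsum_mul X Y : F :=
  fsum_eval (fun u => fsum_eval (fun v => fsum1 (u.1 *[u.2] v.1, v.2)) Y) X.

Definition lop_add (p q : L) : L := \pi_L (repr p + repr q).
Definition lop_mul (p q : L) : L := \pi_L (fsum_mul (repr p) (repr q)).

Lemma fsum_actDr X a b : fsum_act X (a + b) = fsum_act X a + fsum_act X b.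
Proof. by rewrite -fsum_evalDf; apply: eq_fsum_eval => u; rewrite gmulDr. Qed.

Lemma fsum_actDl X Y a : fsum_act (X + Y) a = fsum_act X a + fsum_act Y a.
Proof. exact: fsum_evalD. Qed.

Lemma fsum_act_mul X Y a : fsum_act (fsum_mul X Y) a = fsum_act X (fsum_act Y a).
Proof.
rewrite /fsum_mul (fsum_eval_morph (h := fsum_act^~ a)); last first.
  by move=> u v; apply: fsum_actDl.
apply: eq_fsum_eval => u /=.
rewrite (fsum_eval_morph (h := fsum_act^~ a)); last first.
  by move=> v w; apply: fsum_actDl.
rewrite {2}/fsum_act (fsum_eval_morph (h := gmul u.1 u.2)); last exact: gmulDr.
by apply: eq_fsum_eval => v /=; rewrite /fsum_act fsum_eval1 /= gmulA.
Qed.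

Lemma lop_actDl p q a : lop_act (lop_add p q) a = lop_act p a + lop_act q a.
Proof. by rewrite lop_act_pi fsum_actDl. Qed.

Lemma lop_act_mul p q a : lop_act (lop_mul p q) a = lop_act p (lop_act q a).
Proof. by rewrite lop_act_pi fsum_act_mul. Qed.

Fact lop_addC : commutative lop_add.
Proof. by move=> p q; apply: lop_ext => a; rewrite !lop_actDl Algebra.addrC. Qed.
Fact lop_addA : associative lop_add.
Proof. by move=> p q r; apply: lop_ext => a; rewrite !lop_actDl Algebra.addrA. Qed.
HB.instance Definition _ := Algebra.isAddSemigroup.Build L lop_addC lop_addA.

Fact lop_mulA : associative lop_mul.
Proof. by move=> p q r; apply: lop_ext => a; rewrite !lop_act_mul. Qed.
HB.instance Definition _ := isSemigroup.Build L lop_mulA.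

Fact lop_mulDl (p q r : L) : ((p + q)%R * r)%g = ((p * r)%g + (q * r)%g)%R.
Proof.
apply: lop_ext => a.
by rewrite lop_act_mul !lop_actDl !lop_act_mul.
Qed.
Fact lop_mulDr (p q r : L) : (p * (q + r)%R)%g = ((p * q)%g + (p * r)%g)%R.
Proof.
apply: lop_ext => a.
by rewrite lop_act_mul !lop_actDl !lop_act_mul /lop_act fsum_actDr.
Qed.
HB.instance Definition _ := AddSemigroup_isSemirng.Build L lop_mulDl lop_mulDr.

Lemma lop_piD X Y : \pi_L (X + Y) = \pi_L X + \pi_L Y.
Proof.
apply: lop_ext => a.
by rewrite lop_actDl !lop_act_pi fsum_actDl.
Qed.

Lemma lop_piM X Y : \pi_L (fsum_mul X Y) = (\pi_L X * \pi_L Y)%g.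
Proof.
apply: lop_ext => a.
by rewrite lop_act_mul !lop_act_pi fsum_act_mul.
Qed.

Definition has_left_unity : Prop := exists p : L, forall a, lop_act p a = a.

Definition has_right_unity : Prop :=
  exists X : fsum (G * S)%type,
    forall a : S, fsum_eval (fun u => a *[u.1] u.2) X = a.

End LeftOperatorSemiring.

Arguments lop_gen {G S} x al.
Arguments has_left_unity {G} S.
Arguments has_right_unity {G} S.

Definition fuzzy_subset (R : realType) (X : Type) := X -> {i01 R}.

Section FuzzyIdealGamma.
Variables (R : realType) (G : addSemigroupType) (S : gammaSemiringType G).
Variable mu : fuzzy_subset R S.

Definition fuzzy_left_gideal : Prop :=
  (forall a b : S, Num.min (mu a) (mu b) <= mu (a + b)) /\
  (forall (a b : S) (al : G), mu b <= mu (a *[al] b)).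

Definition fuzzy_right_gideal : Prop :=
  (forall a b : S, Num.min (mu a) (mu b) <= mu (a + b)) /\
  (forall (a b : S) (al : G), mu a <= mu (a *[al] b)).

Definition fuzzy_gideal : Prop := fuzzy_left_gideal /\ fuzzy_right_gideal.

End FuzzyIdealGamma.

Section FuzzyIdeal.
Variables (R : realType) (L : semirngType).
Variable mu : fuzzy_subset R L.

Definition fuzzy_left_ideal : Prop :=
  (forall p q : L, Num.min (mu p) (mu q) <= mu (p + q)) /\
  (forall p q : L, mu q <= mu (p * q)%g).

Definition fuzzy_right_ideal : Prop :=
  (forall p q : L, Num.min (mu p) (mu q) <= mu (p + q)) /\
  (forall p q : L, mu p <= mu (p * q)%g).

Definition fuzzy_ideal : Prop := fuzzy_left_ideal /\ fuzzy_right_ideal.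

End FuzzyIdeal.

Section FuzzyPlus.
Variables (R : realType) (G : addSemigroupType) (S : gammaSemiringType G).
Variable mu : fuzzy_subset R (left_operator S).

Definition fuzzy_plus_val (a : S) : R :=
  inf [set (mu (lop_gen a al))%:num | al in [set: G]]%classic.

Fact fuzzy_plus_ge0 a : 0 <= fuzzy_plus_val a.
Proof.
have [al] := @gsemiring_gamma_inhabited G S.
apply: lb_le_inf; first by exists (mu (lop_gen a al))%:num; exists al.
by move=> _ [be _ <-].
Qed.

Fact fuzzy_plus_le1 a : fuzzy_plus_val a <= 1.
Proof.
have [al] := @gsemiring_gamma_inhabited G S.
apply: (@le_trans _ _ (mu (lop_gen a al))%:num) => //.
apply: ge_inf; last by exists al.
by exists 0 => _ [be _ <-].
Qed.

Definition fuzzy_plus : fuzzy_subset R S :=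
  fun a => Itv01 (fuzzy_plus_ge0 a) (fuzzy_plus_le1 a).

End FuzzyPlus.

(* Main.v *)
Require Import Defs.
From mathcomp Require Import all_boot all_order all_algebra reals interval_inference.

Import Order.TTheory Num.Theory.
Local Open Scope ring_scope.

(** An element of L is determined by its action on S, so for fixed α the map a ↦ [a,α] is additive
    ([lop_genD]), and [aαb,β] = [a,α][b,β] ([lop_genM]). The ideal inequalities of μ at these
    classes thus bound μ([a+b,α]) or μ([aαb,β]) below by values of μ at classes of a and b, hence by
    μ⁺(a) and μ⁺(b). These bounds are uniform in the last index, so they pass to the infimum
    ([le_fuzzy_plus]). *)

Section LopGen.
Variables (G : addSemigroupType) (S : gammaSemiringType G).
Implicit Types (a b : S) (al be : G).

Lemma lop_act_gen a al b : lop_act (lop_gen a al) b = a *[al] b.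
Proof. by rewrite lop_act_pi /fsum_act fsum_eval1. Qed.

Lemma lop_genD a b al : lop_gen (a + b) al = lop_gen a al + lop_gen b al.
Proof. by apply: lop_ext => c; rewrite lop_actDl !lop_act_gen gmulDl. Qed.

(** Both sides send c to aα(bβc), by associativity of the ternary product. *)
Lemma lop_genM a b al be :
  lop_gen (a *[al] b) be = (lop_gen a al * lop_gen b be)%g.
Proof. by apply: lop_ext => c; rewrite lop_act_mul !lop_act_gen gmulA. Qed.

End LopGen.

Section FuzzyPlusInf.
Variables (R : realType) (G : addSemigroupType) (S : gammaSemiringType G).
Variable mu : fuzzy_subset R (left_operator S).

Lemma fuzzy_plus_le (a : S) (al : G) : fuzzy_plus mu a <= mu (lop_gen a al).
Proof.
rewrite -num_le; apply: ge_inf; last by exists al.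
(* [ge_inf] requires a set bounded below; 0 serves because μ takes values in [0,1]. *)
by exists 0 => _ [be _ <-].
Qed.

(** Together with [fuzzy_plus_le], this characterises μ⁺(a) as a greatest lower bound. *)
Lemma le_fuzzy_plus (t : {i01 R}) (a : S) :
  (forall al : G, t <= mu (lop_gen a al)) -> t <= fuzzy_plus mu a.
Proof.
(* Γ must be inhabited here: the real [inf] of an empty set is the default 0, which may lie below
   t. *)
move=> le_t; rewrite -num_le; have [al] := @gsemiring_gamma_inhabited G S.
apply: lb_le_inf; first by exists (mu (lop_gen a al))%:num; exists al.
by move=> _ [be _ <-]; rewrite num_le.
Qed.

Lemma fuzzy_plusD :
  (forall p q, Num.min (mu p) (mu q) <= mu (p + q)) ->
  forall a b : S,
    Num.min (fuzzy_plus mu a) (fuzzy_plus mu b) <= fuzzy_plus mu (a + b).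
Proof.
move=> muD a b; apply: le_fuzzy_plus => al; rewrite lop_genD.
by apply: le_trans (muD _ _); apply: le_min2; apply: fuzzy_plus_le.
Qed.

Lemma fuzzy_plus_left : fuzzy_left_ideal mu -> fuzzy_left_gideal (fuzzy_plus mu).
Proof.
case=> muD muM; split=> [|a b al]; first exact: fuzzy_plusD.
apply: le_fuzzy_plus => be; rewrite lop_genM.
exact: le_trans (fuzzy_plus_le b be) (muM _ _).
Qed.

Lemma fuzzy_plus_right :
  fuzzy_right_ideal mu -> fuzzy_right_gideal (fuzzy_plus mu).
Proof.
case=> muD muM; split=> [|a b al]; first exact: fuzzy_plusD.
(* The lower bound μ([a,α]) keeps the α of the product and does not depend on β, whereas in the left
   case it is μ([b,β]). *)
apply: le_fuzzy_plus => be; rewrite lop_genM.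
exact: le_trans (fuzzy_plus_le a al) (muM _ _).
Qed.

End FuzzyPlusInf.

Theorem proposition3p1 (R : realType) (G : addSemigroupType)
    (S : gammaSemiringType G)
    (left_unity : has_left_unity S) (right_unity : has_right_unity S) :
  (forall mu : fuzzy_subset R (left_operator S),
      fuzzy_left_ideal mu -> fuzzy_left_gideal (fuzzy_plus mu)) /\
  (forall mu : fuzzy_subset R (left_operator S),
      fuzzy_right_ideal mu -> fuzzy_right_gideal (fuzzy_plus mu)) /\
  (forall mu : fuzzy_subset R (left_operator S),
      fuzzy_ideal mu -> fuzzy_gideal (fuzzy_plus mu)).
Proof.
split; first exact: fuzzy_plus_left.
split; first exact: fuzzy_plus_right.
move=> mu [muL muR]; split; [exact: fuzzy_plus_left|exact: fuzzy_plus_right].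
Qed.
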